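(* Let $\Gamma$ be a finite simplicial graph and let $F$ be a field. Set $V=H^1(A(\Gamma),F)$ and $W=H^2(A(\Gamma),F)$, and let $q\colon V\times V\to W$ be the cup product pairing. Then $\Gamma$ admits a Hamiltonian cycle if and only if the triple $(V,W,q)$ is cyclic Hamiltonian.
   Context: A finite simplicial graph is a finite undirected graph with no loops and no multiple edges (i.e. a simple graph), with vertex set $V(\Gamma)$ and edge set $E(\Gamma)$. The right-angled Artin group on $\Gamma$ is $A(\Gamma)=\langle V(\Gamma)\mid [v,w]=1 \text{ for all } \{v,w\}\in E(\Gamma)\rangle$. $H^*(A(\Gamma),F)$ denotes group cohomology with (trivial) coefficients in $F$. A Hamiltonian cycle in $\Gamma$ is a cycle that visits every vertex of $\Gamma$ exactly once; that is, an ordering $v_1,\ldots,v_n$ of all the vertices such that $\{v_i,v_{i+1}\}$ is an edge for $1\le i<n$ and $\{v_n,v_1\}$ is an edge. (With this convention, a single edge on two vertices counts as having a Hamiltonian cycle, and a one-vertex graph has none.) Let $V,W$ be vector spaces over a field $F$ with $V$ finite dimensional and let $q\colon V\times V\to W$ be a symmetric or anti-symmetric bilinear pairing. The triple $(V,W,q)$ is called cyclic Hamiltonian if for every basis $\{w_1,\ldots,w_n\}$ of $V$ there is a permutation $\sigma\in S_n$ such that $q(w_{\sigma(i)},w_{\sigma(i+1)})\neq 0$ for all $1\leq i<n$, and also $q(w_{\sigma(n)},w_{\sigma(1)})\neq 0$. *)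

(* Defs.v *)
From HB Require Import structures.
From mathcomp Require Import all_boot all_algebra perm monoid.
From mathcomp Require Import sesquilinear ring_quotient.
From mathcomp Require Import boolp functions ring.

Set Implicit Arguments.
Unset Strict Implicit.
Unset Printing Implicit Defensive.

Import GRing.Theory.
Import Quotient.
Local Open Scope ring_scope.
Local Open Scope quotient_scope.

Section Presentation.
Variable S : choiceType.

(* (s, false) stands for the generator s and (s, true) for its inverse. *)
Definition word : Type := seq (S * bool).

Definition word_inv (w : word) : word := rev [seq (l.1, ~~ l.2) | l <- w].

Variable R : word -> Prop.

Inductive word_eq : word -> word -> Prop :=
| word_eq_refl u : word_eq u u
| word_eq_sym u v : word_eq u v -> word_eq v u
| word_eq_trans v u w : word_eq u v -> word_eq v w -> word_eq u w
| word_eq_cat u u' v v' :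
    word_eq u u' -> word_eq v v' -> word_eq (u ++ v) (u' ++ v')
| word_eq_cancel s b : word_eq [:: (s, b); (s, ~~ b)] [::]
| word_eq_relator r : R r -> word_eq r [::].

Definition word_eqb : rel (seq (S * bool)) := fun u v => `[< word_eq u v >].

Lemma word_eqb_equiv : equiv_class_of word_eqb.
Proof.
split=> [u|u v|v u w]; rewrite /word_eqb.
- by apply/asboolP/word_eq_refl.
- by apply/asboolP/asboolP; apply: word_eq_sym.
- move=> /asboolP uv /asboolP vw; apply/asboolP; exact: word_eq_trans uv vw.
Qed.

Canonical word_eqb_equivRel := EquivRelPack word_eqb_equiv.
Canonical word_eqb_encModRel := defaultEncModRel word_eqb.

Definition presented := {eq_quot word_eqb}.
HB.instance Definition _ := Choice.on presented.
HB.instance Definition _ : EqQuotient _ word_eqb presented :=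
  EqQuotient.on presented.

Definition word_class (u : word) : presented := \pi u.

Lemma word_classP u v : word_class u = word_class v <-> word_eq u v.
Proof.
split=> [/eqP|uv]; first by rewrite piE => /asboolP.
by apply/eqP; rewrite piE; apply/asboolP.
Qed.

Lemma word_class_repr x : word_class (repr x) = x.
Proof. exact: reprK. Qed.

Lemma word_eq_repr u : word_eq (repr (word_class u)) u.
Proof. by apply/word_classP; rewrite word_class_repr. Qed.

Lemma word_inv_cat u v : word_inv (u ++ v) = word_inv v ++ word_inv u.
Proof. by rewrite /word_inv map_cat rev_cat. Qed.

Lemma word_invK : involutive word_inv.
Proof.
move=> u; rewrite /word_inv map_rev revK -map_comp -[RHS]map_id.
by apply: eq_map => -[s b] /=; rewrite negbK.
Qed.

Lemma word_eq_invr u : word_eq (u ++ word_inv u) [::].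
Proof.
elim/last_ind: u => [|u [s b] IHu]; first exact: word_eq_refl.
rewrite -cats1 word_inv_cat -catA /= -cat1s.
apply: word_eq_trans IHu; apply: word_eq_cat; first exact: word_eq_refl.
rewrite -[X in word_eq _ X]cat0s -[X in word_eq X _]/([:: (s, b); (s, ~~ b)] ++ _).
by apply: word_eq_cat; [exact: word_eq_cancel | exact: word_eq_refl].
Qed.

Lemma word_eq_invl u : word_eq (word_inv u ++ u) [::].
Proof. by rewrite -{2}[u]word_invK; exact: word_eq_invr. Qed.

Lemma word_eq_inv u v : word_eq u v -> word_eq (word_inv u) (word_inv v).
Proof.
move=> uv.
have h : word_eq (word_inv u ++ (v ++ word_inv v)) (word_inv u).
  rewrite -[X in word_eq _ X]cats0; apply: word_eq_cat; first exact: word_eq_refl.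
  exact: word_eq_invr.
apply: word_eq_trans (word_eq_sym h) _; rewrite catA -[X in word_eq _ X]cat0s.
apply: word_eq_cat; last exact: word_eq_refl.
apply: word_eq_trans (word_eq_invl u).
by apply: word_eq_cat; [exact: word_eq_refl | exact: word_eq_sym].
Qed.

Definition presented_one : presented := word_class [::].
Definition presented_inv (x : presented) : presented := word_class (word_inv (repr x)).
Definition presented_mul (x y : presented) : presented :=
  word_class (repr x ++ repr y).

Lemma presented_mulE u v :
  presented_mul (word_class u) (word_class v) = word_class (u ++ v).
Proof. by apply/word_classP/word_eq_cat; apply: word_eq_repr. Qed.

Lemma presented_invE u : presented_inv (word_class u) = word_class (word_inv u).
Proof. by apply/word_classP/word_eq_inv/word_eq_repr. Qed.

Lemma presented_mulA : associative presented_mul.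
Proof.
by move=> x y z; rewrite -(word_class_repr x) -(word_class_repr y) -(word_class_repr z) !presented_mulE catA.
Qed.

Lemma presented_mul1 : left_id presented_one presented_mul.
Proof. by move=> x; rewrite -(word_class_repr x) presented_mulE. Qed.

Lemma presented_mulr1 : right_id presented_one presented_mul.
Proof. by move=> x; rewrite -(word_class_repr x) presented_mulE cats0. Qed.

Lemma presented_mulV : left_inverse presented_one presented_inv presented_mul.
Proof.
move=> x; rewrite -(word_class_repr x) presented_invE presented_mulE.
by apply/word_classP/word_eq_invl.
Qed.

Lemma presented_mulrV : right_inverse presented_one presented_inv presented_mul.
Proof.
move=> x; rewrite -(word_class_repr x) presented_invE presented_mulE.
by apply/word_classP/word_eq_invr.
Qed.

HB.instance Definition _ := isGroup.Build presented presented_mulA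
  presented_mul1 presented_mulr1 presented_mulV presented_mulrV.

Definition presented_gen (s : S) : presented := word_class [:: (s, false)].

End Presentation.

Section Cohomology.
Variables (G : groupType) (F : fieldType).

(* Inhomogeneous cochains. *)
Definition cochain (n : nat) : Type := ('I_n -> G) -> F^o.
HB.instance Definition _ n := GRing.Lmodule.on (cochain n).

(* The faces of the bar complex: the outer ones (j = 0 and j = n + 1) drop
   the first, resp. the last, entry of x = (x_0, ..., x_n); the j-th inner
   one multiplies x_(j-1) and x_j. *)
Definition face (n : nat) (j : 'I_n.+2) (x : 'I_n.+1 -> G) : 'I_n -> G :=
  fun k =>
    let x0 := x (widen_ord (leqnSn n) k) in
    let x1 := x (lift ord0 k) in
    if (k.+1 < j)%N then x0 else if k.+1 == j :> nat then (x0 * x1)%g else x1.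

Definition coboundary (n : nat) (f : cochain n) : cochain n.+1 :=
  fun x => \sum_(j < n.+2) (-1) ^+ j * f (face j x).

Lemma coboundary_linear n : linear (@coboundary n).
Proof.
move=> a f g; apply: funext => x; rewrite /coboundary.
rewrite -[RHS]/(a * (\sum_(j < n.+2) _) + \sum_(j < n.+2) _) mulr_sumr -big_split.
by apply: eq_bigr => j _; rewrite /= mulrCA -mulrDr.
Qed.

HB.instance Definition _ n :=
  GRing.isLinear.Build F (cochain n) (cochain n.+1) _ _ (@coboundary_linear n).

Definition is_cocycle n : {pred cochain n} := [pred f | coboundary f == 0].

Lemma is_cocycle_submod n : submod_closed (@is_cocycle n).
Proof.
split=> [|a f g]; rewrite !inE ?linear0 // => /eqP df0 /eqP dg0.
by rewrite linearP /= df0 dg0 scaler0 addr0.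
Qed.

HB.instance Definition _ n :=
  GRing.isSubmodClosed.Build F (cochain n) (@is_cocycle n)
    (@is_cocycle_submod n).

Record cocycle n := Cocycle {
  cocycle_val :> cochain n;
  cocycle_valP : cocycle_val \in @is_cocycle n }.
HB.instance Definition _ n := [isSub for @cocycle_val n].
HB.instance Definition _ n := [Choice of cocycle n by <:].
HB.instance Definition _ n := [SubChoice_isSubLmodule of cocycle n by <:].

Definition is_coboundary n : cochain n -> Prop :=
  match n with
  | 0 => fun f => f = 0
  | _.+1 => fun f => exists h, f = coboundary h
  end.

Definition coboundaries n : {pred cocycle n} :=
  [pred z | `[< is_coboundary (val z) >]].

Lemma coboundaries_submod n : submod_closed (@coboundaries n).
Proof.
split=> [|a z t]; rewrite !inE.
  by apply/asboolP; case: n => [|n] //=; exists 0; rewrite linear0.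
case: n z t => [|n] z t /asboolP + /asboolP + => /=.
  by move=> zE tE; apply/asboolP; rewrite /= zE tE scaler0 addr0.
move=> [h zE] [k tE]; apply/asboolP; exists (a *: h + k).
by rewrite linearP /= -zE -tE.
Qed.

HB.instance Definition _ n :=
  GRing.isSubmodClosed.Build F (cocycle n) (@coboundaries n)
    (@coboundaries_submod n).

Definition cohomology n := {quot @coboundaries n}.
HB.instance Definition _ n := GRing.Zmodule.on (cohomology n).
HB.instance Definition _ n : EqQuotient _ (equiv (@coboundaries n)) _ :=
  EqQuotient.on (cohomology n).

Definition cohom_class n (z : cocycle n) : cohomology n := \pi z.

Lemma cohom_classP n (z t : cocycle n) :
  cohom_class z = cohom_class t <-> is_coboundary (val (z - t)).
Proof.
split=> [/eqP|zt]; first by rewrite piE equivE => /asboolP.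
by apply/eqP; rewrite piE equivE; apply/asboolP.
Qed.

Lemma cohom_class_repr n (c : cohomology n) : cohom_class (repr c) = c.
Proof. exact: reprK. Qed.

Lemma cohom_class_zmod n : zmod_morphism (@cohom_class n).
Proof. by move=> z t; rewrite /cohom_class !piE. Qed.

HB.instance Definition _ n :=
  GRing.isZmodMorphism.Build _ _ (@cohom_class n) (@cohom_class_zmod n).

Definition cohom_scale n (a : F) (c : cohomology n) : cohomology n :=
  cohom_class (a *: repr c).

Lemma cohom_scaleE n a (z : cocycle n) :
  cohom_scale a (cohom_class z) = cohom_class (a *: z).
Proof.
apply/cohom_classP/asboolP; rewrite -scalerBr.
have : repr (cohom_class z) - z \in @coboundaries n.
  by apply/asboolP/cohom_classP; rewrite cohom_class_repr.
exact: rpredZ.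
Qed.

Lemma cohom_scaleA n a b (c : cohomology n) :
  cohom_scale a (cohom_scale b c) = cohom_scale (a * b) c.
Proof. by rewrite -(cohom_class_repr c) !cohom_scaleE scalerA. Qed.

Lemma cohom_scale1 n : left_id 1 (@cohom_scale n).
Proof. by move=> c; rewrite -(cohom_class_repr c) cohom_scaleE scale1r. Qed.

Lemma cohom_scaleDr n : right_distributive (@cohom_scale n) +%R.
Proof.
move=> a c d; rewrite -(cohom_class_repr c) -(cohom_class_repr d).
by rewrite -raddfD !cohom_scaleE scalerDr raddfD.
Qed.

Lemma cohom_scaleDl n (c : cohomology n) :
  {morph (@cohom_scale n)^~ c : a b / a + b}.
Proof.
move=> a b /=; rewrite -(cohom_class_repr c).
by rewrite !cohom_scaleE scalerDl raddfD.
Qed.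

HB.instance Definition _ n := GRing.Zmodule_isLmodule.Build F (cohomology n)
  (@cohom_scaleA n) (@cohom_scale1 n) (@cohom_scaleDr n) (@cohom_scaleDl n).

Lemma cohom_class_scalable n : scalable (@cohom_class n).
Proof. by move=> a z; rewrite -cohom_scaleE. Qed.

HB.instance Definition _ n := GRing.isScalable.Build F _ _ _ (@cohom_class n)
  (@cohom_class_scalable n).

Definition cup p q (f : cochain p) (g : cochain q) : cochain (p + q) :=
  fun x => f (fun i => x (lshift q i)) * g (fun j => x (rshift p j)).

Lemma coboundary0E (h : cochain 0) : coboundary h = 0.
Proof.
apply: funext => x; rewrite /coboundary 2!big_ord_recl big_ord0 /=.
rewrite expr0 mul1r expr1 mulN1r addr0.
have -> : face (lift ord0 ord0) x = face ord0 x by apply: funext => -[].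
exact: subrr.
Qed.

Lemma coboundary1E (f : cochain 1) (x : 'I_2 -> G) :
  coboundary f x = f (fun=> x (lift ord0 ord0))
    - f (fun=> (x ord0 * x (lift ord0 ord0))%g) + f (fun=> x ord0).
Proof.
rewrite /coboundary !big_ord_recl big_ord0 /= !expr0 !expr1 /bump /=.
rewrite mul1r mulN1r sqrrN expr1n mul1r addr0 addrA.
by congr (f _ - f _ + f _); apply: funext => i; rewrite (ord1 i) /face /=;
  (congr (_ * _)%g || idtac); congr x; apply: val_inj.
Qed.

Lemma is_coboundary1 (f : cochain 1) : is_coboundary f -> f = 0.
Proof. by case=> h ->; rewrite coboundary0E. Qed.

Lemma cocycle1M (z : cocycle 1) a b :
  val z (fun=> (a * b)%g) = val z (fun=> a) + val z (fun=> b).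
Proof.
have /eqP/(congr1 (fun f => f (fun i => if i == ord0 then a else b))) :=
  cocycle_valP z.
rewrite coboundary1E /= => /eqP; rewrite addrAC subr_eq0 => /eqP <-.
exact: addrC.
Qed.

Lemma cup11E (f g : cochain 1) (x : 'I_2 -> G) :
  cup f g x = f (fun=> x ord0) * g (fun=> x (lift ord0 ord0)).
Proof.
by congr (f _ * g _); apply: funext => i; rewrite (ord1 i); congr x;
  apply: val_inj.
Qed.

Lemma cup_cocycle (z t : cocycle 1) : cup z t \in @is_cocycle (1 + 1).
Proof.
rewrite inE; apply/eqP/funext => x.
pose x0 := x ord0; pose x1 := x (lift ord0 ord0).
pose x2 := x (lift ord0 (lift ord0 ord0)).
have cupE j a b : face j x ord0 = a -> face j x (lift ord0 ord0) = b ->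
    cup (val z) (val t) (face j x) = val z (fun=> a) * val t (fun=> b).
  by move=> <- <-; exact: cup11E.
rewrite /coboundary 4!big_ord_recl big_ord0.
rewrite (cupE _ x1 x2) // (cupE _ (x0 * x1)%g x2) //; last first.
  by rewrite /face /=; congr (x _ * _)%g; apply: val_inj.
rewrite (cupE _ x0 (x1 * x2)%g); first 1 last.
- by rewrite /face /=; congr x; apply: val_inj.
- by rewrite /face /=; congr (x _ * _)%g; apply: val_inj.
rewrite (cupE _ x0 x1); first 1 last.
- by rewrite /face /=; congr x; apply: val_inj.
- by rewrite /face /=; congr x; apply: val_inj.
rewrite !cocycle1M /bump /= -[RHS]/(0 : F).
ring.
Qed.

Definition cup_cocycles (z t : cocycle 1) : cocycle 2 :=
  Cocycle (cup_cocycle z t).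

(* The product H^1 x H^1 -> H^2 induced by [cup]; see [cup_cohomE]. *)
Definition cup_cohom (c d : cohomology 1) : cohomology 2 :=
  cohom_class (cup_cocycles (repr c) (repr d)).

Lemma repr_cohom_class1 (z : cocycle 1) : repr (cohom_class z) = z.
Proof.
apply/eqP; rewrite -subr_eq0; apply/eqP/val_inj/is_coboundary1.
by apply/cohom_classP; rewrite cohom_class_repr.
Qed.

Lemma cup_cohomE (z t : cocycle 1) :
  cup_cohom (cohom_class z) (cohom_class t) = cohom_class (cup_cocycles z t).
Proof. by rewrite /cup_cohom !repr_cohom_class1. Qed.

Lemma cup_cohom_bilinear : bilinear_for *:%R *:%R cup_cohom.
Proof.
split=> c a d d'; rewrite -(cohom_class_repr c) -(cohom_class_repr d)
  -(cohom_class_repr d') -linearP !cup_cohomE -linearP; congr cohom_class;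
  apply/val_inj/funext => x /=; rewrite /cup.
- by rewrite -[RHS]/(a * (_ * _) + _ * _) mulrA -mulrDl.
- by rewrite -[RHS]/(a * (_ * _) + _ * _) mulrCA -mulrDr.
Qed.

HB.instance Definition _ :=
  bilinear_isBilinear.Build F (cohomology 1) (cohomology 1) (cohomology 2)
    *:%R *:%R cup_cohom cup_cohom_bilinear.

Lemma cup_cohom_anti (c d : cohomology 1) : cup_cohom c d = - cup_cohom d c.
Proof.
have ringE (z0 z1 t0 t1 : F) :
    z0 * t1 - - (t0 * z1) = - (z1 * t1) - - ((z0 + z1) * (t0 + t1)) - z0 * t0.
  by ring.
rewrite -(cohom_class_repr c) -(cohom_class_repr d) !cup_cohomE -raddfN.
move: (repr c) (repr d) => z t; apply/cohom_classP.
exists (fun x => - (val z x * val t x)); apply: funext => x.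
rewrite coboundary1E !cocycle1M -[LHS]/(cup z t x - - cup t z x) !cup11E.
exact: ringE.
Qed.

End Cohomology.

Arguments cohom_class {G F n} z.

Section Raag.
Variables (T : finType) (e : rel T).

Definition commutator_word (v w : T) : word T :=
  [:: (v, false); (w, false); (v, true); (w, true)].

Definition raag_relator (r : word T) : Prop :=
  exists v w, e v w /\ r = commutator_word v w.

Definition raag : Type := presented raag_relator.
HB.instance Definition _ := Group.on raag.

Definition raag_gen (v : T) : raag := presented_gen raag_relator v.

Variable F : fieldType.

Definition word_sum (u : T -> F) (w : word T) : F :=
  \sum_(l <- w) if l.2 then - u l.1 else u l.1.

Lemma word_sum_cons u l w :
  word_sum u (l :: w) = (if l.2 then - u l.1 else u l.1) + word_sum u w.
Proof. exact: big_cons. Qed.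

Lemma word_sum_eq u w w' :
  word_eq raag_relator w w' -> word_sum u w = word_sum u w'.
Proof.
elim=> //.
- by move=> w1 w2 w3 _ -> _ ->.
- by move=> w1 w1' w2 w2' _ E1 _ E2; rewrite /word_sum !big_cat -!/(word_sum _ _) /= E1 E2.
- move=> s b; rewrite /word_sum !big_cons !big_nil /= addr0.
  by case: b; rewrite /= ?subrr ?addNr.
- move=> _ [v [v' [_ ->]]]; rewrite /word_sum !big_cons !big_nil /=.
  ring.
Qed.

Definition raag_hom (u : T -> F) : cochain raag F 1 :=
  fun x => word_sum u (repr (x ord0)).

Lemma raag_hom_class u w :
  raag_hom u (fun=> word_class raag_relator w) = word_sum u w.
Proof. exact/word_sum_eq/word_eq_repr. Qed.

Lemma raag_hom_cocycle u : raag_hom u \in @is_cocycle raag F 1.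
Proof.
rewrite inE; apply/eqP/funext => x; rewrite coboundary1E.
move: (x ord0) (x _) => a b.
rewrite -(word_class_repr a) -(word_class_repr b).
rewrite -[(_ * _)%g]/(presented_mul _ _) presented_mulE !raag_hom_class.
rewrite /word_sum big_cat /= -[RHS]/(0 : F); ring.
Qed.

Definition raag_coords (c : cohomology raag F 1) : 'rV[F]_#|T| :=
  \row_i val (repr c) (fun=> raag_gen (enum_val i)).

Lemma raag_coords_linear : linear raag_coords.
Proof.
move=> a c d; apply/rowP => i.
rewrite -(cohom_class_repr c) -(cohom_class_repr d) -linearP.
by rewrite !mxE !repr_cohom_class1.
Qed.

Lemma cocycle_word (z : cocycle raag F 1) w :
  val z (fun=> word_class raag_relator w)
    = word_sum (fun v => val z (fun=> raag_gen v)) w.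
Proof.
have z1 : val z (fun=> 1%g) = 0.
  by apply: (addrI (val z (fun=> 1%g))); rewrite -cocycle1M mulg1 addr0.
elim: w => [|[s b] w IHw]; first by rewrite /word_sum big_nil -[RHS]z1.
rewrite word_sum_cons -IHw -cat1s -presented_mulE cocycle1M; congr (_ + _); case: b => //=.
apply/eqP; rewrite -addr_eq0 -cocycle1M -[X in X == _]/(val z _) -z1; apply/eqP.
congr (val z _); apply: funext => _.
rewrite -[(_ * _)%g]/(presented_mul _ _) presented_mulE.
by apply/word_classP; apply: (word_eq_cancel _ s true).
Qed.

Lemma raag_coords_bij : bijective raag_coords.
Proof.
pose h (u : 'rV[F]_#|T|) := Cocycle (raag_hom_cocycle (fun v => u 0 (enum_rank v))).
exists (fun u => cohom_class (h u)) => [c|u].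
- rewrite -[RHS]cohom_class_repr; congr cohom_class.
  apply/val_inj/funext => x /=.
  have -> : x = fun=> word_class raag_relator (repr (x ord0)).
    by apply: funext => i; rewrite (ord1 i) word_class_repr.
  rewrite raag_hom_class cocycle_word; apply: eq_bigr => l _.
  by rewrite !mxE enum_rankK.
- apply/rowP => i; rewrite mxE repr_cohom_class1 /= raag_hom_class.
  by rewrite /word_sum big_seq1 enum_valK.
Qed.

HB.instance Definition _ :=
  Lmodule_hasFinDim.Build F (cohomology raag F 1)
    (exist2 _ _ raag_coords raag_coords_linear raag_coords_bij).

End Raag.

(* The empty cycle [::] is allowed: the empty graph is Hamiltonian. *)
Definition hamiltonian (T : finType) (e : rel T) : Prop :=
  exists2 s : seq T, ucycle e s & forall v, v \in s.

Section Pairing.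
Variables (F : fieldType) (V : vectType F) (W : lmodType F).

Record sym_pairing := SymPairing {
  pairing :> {bilinear V -> V -> W};
  pairingC : (forall x y, pairing x y = pairing y x)
    \/ (forall x y, pairing x y = - pairing y x) }.

(* [ordS] is the successor on 'I_n modulo n, so that i = n - 1 gives the
   closing condition between the last and the first vectors. *)
Definition cyclic_hamiltonian (q : sym_pairing) : Prop :=
  forall (n : nat) (w : n.-tuple V), basis_of fullv w ->
  exists s : 'S_n, forall i : 'I_n, q (tnth w (s i)) (tnth w (s (ordS i))) != 0.

End Pairing.

Definition cup_pairing (T : finType) (e : rel T) (F : fieldType) :
    sym_pairing (cohomology (raag e) F 1) (cohomology (raag e) F 2) :=
  SymPairing (pairing := @cup_cohom (raag e) F)
    (or_intror (@cup_cohom_anti (raag e) F)).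

(* Main.v *)
From HB Require Import structures.
Require Import Defs.
From mathcomp Require Import all_boot all_algebra.
From mathcomp Require Import perm boolp ring.

(** A class in H^1 is a function on the vertices, namely its values on the
generators.  The cup product of [c] and [d] is nonzero exactly when some edge
[xy] has a nonzero minor [c x * d y - c y * d x] ([cup_cohom_neq0]): a
coboundary is symmetric on commuting elements, so a nonzero minor is an
obstruction, and if all the edge minors vanish then [c] and [d] are the two
abelian coordinates of a homomorphism to the Heisenberg group, whose central
coordinate bounds the cup product.

So a basis of H^1 is an invertible matrix with columns indexed by the
vertices, and two rows have a nonzero product when they have a nonzero minor
on the columns of some edge; call such rows adjacent.  The vertex basis gives
the identity matrix, for which adjacency of rows is the graph itself, and this
shows that a cyclic Hamiltonian pairing comes from a Hamiltonian graph.

For the other direction more is true: for every graph and every invertible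
matrix there is a bijection from the columns to the rows that takes edges to
adjacent rows ([row_graph_embedding]), and any Hamiltonian cycle can then be
transported.  To find it, write each row as the sum of its restrictions to the
connected components of its support.  The determinant is multilinear, so one
restriction [c_i] can be chosen from each row so that the [c_i] are still
linearly independent; a nonzero term in the expansion of their determinant
attaches to each row a column at which [c_i] does not vanish.  Suppose that
the columns [v] and [w] attached to rows [i] and [j] form an edge, but that
rows [i] and [j] are not adjacent.  Both rows are then nonzero at [v] and at
[w], and, following the edges inside the support, they are proportional on the
component of [v] and have the same component there.  So [c_i] and [c_j] are
proportional, which contradicts independence. *)

Set Implicit Arguments.
Unset Strict Implicit.
Unset Printing Implicit Defensive.
Import GRing.Theory.
Local Open Scope ring_scope.

(** * The graph on the rows of an invertible matrix *)

Section RowGraph.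
Variables (F : fieldType) (n : nat).

(** Multilinearity of the determinant in all the rows at once. *)
Lemma det_rows_sum (I : finType) (c : 'I_n -> I -> 'I_n -> F) :
  \det (\matrix_(i, j) \sum_k c i k j)
    = \sum_(f : {ffun 'I_n -> I}) \det (\matrix_(i, j) c i (f i) j).
Proof.
rewrite /determinant exchange_big; apply: eq_bigr => s _ /=.
rewrite -mulr_sumr; congr (_ * _).
under eq_bigr do rewrite mxE.
rewrite bigA_distr_bigA; apply: eq_bigr => f _.
by apply: eq_bigr => i _; rewrite mxE.
Qed.

Lemma det_neq0_transversal (A : 'M[F]_n) :
  \det A != 0 -> exists s : 'S_n, forall i, A i (s i) != 0.
Proof.
move=> detA; case: (pickP (fun s : 'S_n => [forall i, A i (s i) != 0])).
  by move=> s /forallP As; exists s.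
move=> noS; case/eqP: detA; rewrite /determinant big1 // => s _.
have /negbT := noS s; rewrite negb_forall => /existsP[i /negPn /eqP Ai].
by rewrite (bigD1 i) //= Ai mul0r mulr0.
Qed.

Lemma det_row_scale (A : 'M[F]_n) (i j : 'I_n) a :
  i != j -> (forall k, A i k = a * A j k) -> \det A = 0.
Proof.
move=> ij Aij; apply/eqP/det0P; exists (delta_mx 0 i - a *: delta_mx 0 j).
  apply/eqP => /rowP/(_ i)/eqP; rewrite !mxE !eqxx (negPf ij) mulr0 subr0.
  by rewrite oner_eq0.
rewrite mulmxBl -scalemxAl -!rowE; apply/rowP => k.
by rewrite !mxE Aij subrr.
Qed.

Variables (e : rel 'I_n).
Hypotheses (e_sym : symmetric e) (e_irr : irreflexive e).

Definition support_rel (r : 'I_n -> F) : rel 'I_n :=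
  [rel x y | [&& e x y, r x != 0 & r y != 0]].

Lemma support_rel_sym r : connect_sym (support_rel r).
Proof.
apply: sym_connect_sym => x y.
by rewrite /support_rel /= e_sym [(r x != 0) && _]andbC.
Qed.

(** The common ratio of two rows that are not adjacent is carried along each
edge inside the support; the vanishing minor forces [b] not to vanish at
the new vertex, so the component of [b] contains that of [a]. *)
Lemma support_rel_proportional (a b : 'I_n -> F) l x y :
  (forall k m, e k m -> a k * b m = a m * b k) ->
  a x = l * b x -> l != 0 ->
  connect (support_rel a) x y -> connect (support_rel b) x y /\ a y = l * b y.
Proof.
move=> ab + l0 /connectP[p + ->].
elim: p x => [|z p IHp] x /= ax; first by split; first exact: connect0.
case/andP=> /and3P[exz ax0 az0] pth.
have bx0 : b x != 0 by apply: contraNneq ax0 => bx; rewrite ax bx mulr0.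
have az : a z = l * b z.
  by apply: (mulIf bx0); rewrite -ab // ax mulrAC.
have bz0 : b z != 0 by apply: contraNneq az0 => bz; rewrite az bz mulr0.
have [czy ay] := IHp z az pth; split=> //.
by apply: connect_trans czy; apply: connect1; rewrite /support_rel /= exz bx0.
Qed.

(** Every graph on the columns of an invertible matrix embeds, as a spanning
subgraph, in the adjacency graph of the rows. *)
Lemma row_graph_embedding (A : 'M[F]_n) : \det A != 0 ->
  exists s : 'S_n, forall i j, e (s i) (s j) ->
    exists k m, e k m /\ A i k * A j m != A i m * A j k.
Proof.
pose rt i := fingraph.root (support_rel (A i)).
pose c i k j := if rt i j == k then A i j else 0.
(* [c i k] is the restriction of row [i] to the component with root [k]. *)
have AE : A = \matrix_(i, j) \sum_k c i k j.
  by apply/matrixP => i j; rewrite mxE -big_mkcond (big_pred1 (rt i j)).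
rewrite [in \det _]AE det_rows_sum => detA.
have [f detC] : exists f : {ffun 'I_n -> 'I_n},
    \det (\matrix_(i, j) c i (f i) j) != 0.
  apply/existsP; apply: contraNT detA; rewrite negb_exists => /forallP C0.
  by apply/eqP/big1 => f _; apply/eqP; have := C0 f; rewrite negbK.
have [s Cs] := det_neq0_transversal detC.
have /all_and2[fE A0] i : f i = rt i (s i) /\ A i (s i) != 0.
  have := Cs i; rewrite mxE /c.
  by case: (rt i (s i) =P f i) => // _; rewrite eqxx.
exists s => i j eij; apply: contrapT => noedge.
have minor0 k m : e k m -> A i k * A j m = A i m * A j k.
  by move=> ekm; apply: contrapT => /eqP km0; apply: noedge; exists k, m.
have minor_ij := minor0 _ _ eij.
have Aji0 : A j (s i) != 0.
  apply: contra_eq_neq minor_ij => ->; rewrite mulr0.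
  by rewrite mulf_neq0.
pose l := A i (s i) / A j (s i).
have l0 : l != 0 by rewrite mulf_neq0 ?invr_eq0.
have lE : A i (s i) = l * A j (s i) by rewrite divfK.
have lE' : A j (s i) = l^-1 * A i (s i) by rewrite lE mulKf.
have minor0' k m : e k m -> A j k * A i m = A j m * A i k.
  by move=> ekm; rewrite mulrC -minor0 // mulrC.
have cE k : (rt i k == f i) = connect (support_rel (A i)) (s i) k.
  by rewrite fE eq_sym (root_connect (support_rel_sym (A i))).
(* [s i] and [s j] are adjacent vertices in the support of row [j]. *)
have cE' k : (rt j k == f j) = connect (support_rel (A j)) (s i) k.
  rewrite fE eq_sym (root_connect (support_rel_sym (A j))).
  apply: (same_connect (support_rel_sym (A j))); apply: connect1.
  by rewrite /support_rel /= e_sym eij A0 Aji0.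
have ij : i != j by apply: contraTneq eij => ->; rewrite e_irr.
case/eqP: detC; apply: (@det_row_scale _ i j l) => // k.
rewrite !mxE /c cE cE'.
have P1 := @support_rel_proportional _ _ _ _ k minor0 lE l0.
have P2 := @support_rel_proportional _ _ _ _ k minor0' lE' (invr_neq0 l0).
case: ifP => [/P1[-> //]|nc]; case: ifP => [/P2[]|_]; last by rewrite mulr0.
by rewrite nc.
Qed.

End RowGraph.

(** * Cup products in terms of edge minors *)

Section CupProduct.
Variables (T : finType) (e : rel T) (F : fieldType).

Section Heisenberg.
Variables a b : T -> F.

(** The central coordinate of the image of a word in the Heisenberg group with
product [(a, b, c) (a', b', c') = (a + a', b + b', c + c' - a b')], when the
generator [v] goes to [(a v, b v, 0)]; the inverse of this element is
[(- a v, - b v, - (a v * b v))]. *)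
Fixpoint heisenberg (w : word T) : F :=
  if w is l :: w' then
    (if l.2 then - (a l.1 * b l.1) else 0) + heisenberg w'
      - (if l.2 then - a l.1 else a l.1) * word_sum b w'
  else 0.

Lemma heisenberg_cat u v :
  heisenberg (u ++ v) = heisenberg u + heisenberg v - word_sum a u * word_sum b v.
Proof.
elim: u => [|l u IHu] /=; first by rewrite /word_sum big_nil mul0r subr0 add0r.
rewrite IHu word_sum_cons /word_sum big_cat /=; ring.
Qed.

(** The images of two generators commute in the Heisenberg group when the
minor of the edge between them vanishes, so the relators are respected. *)
Lemma heisenberg_eq u v :
    (forall x y, e x y -> a x * b y = a y * b x) ->
  word_eq (raag_relator e) u v -> heisenberg u = heisenberg v.
Proof.
move=> minor0; elim=> {u v} //.
- by move=> u v w _ -> _ ->.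
- move=> u u' v v' uu' Eu vv' Ev; rewrite !heisenberg_cat Eu Ev.
  by rewrite (word_sum_eq a uu') (word_sum_eq b vv').
- move=> x c; rewrite /= /word_sum !big_cons !big_nil /=.
  by case: c => /=; ring.
- move=> _ [x [y [exy ->]]]; rewrite /= /word_sum !big_cons !big_nil /=.
  have := minor0 _ _ exy; move: (a x) (a y) (b x) (b y) => a1 a2 b1 b2 E.
  ring: E.
Qed.

End Heisenberg.

Lemma raag_gen_comm x y : e x y ->
  (raag_gen e x * raag_gen e y = raag_gen e y * raag_gen e x)%g.
Proof.
move=> exy.
have rel1 : (raag_gen e x * raag_gen e y *
    ((raag_gen e x)^-1 * (raag_gen e y)^-1) = 1)%g.
  have invE v : (raag_gen e v)^-1%g = word_class (raag_relator e) [:: (v, true)].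
    exact: presented_invE.
  rewrite !invE /raag_gen /presented_gen -![(_ * _)%g]/(presented_mul _ _).
  rewrite !presented_mulE.
  by apply/word_classP/word_eq_relator; exists x, y.
by move/eqP: rel1; rewrite -invgM divg_eq1 => /eqP.
Qed.

Definition on_gen (z : cocycle (raag e) F 1) (v : T) : F :=
  val z (fun=> raag_gen e v).

(** The edge minors are the values of the cup product on the tori spanned by
pairs of commuting generators, and these detect it. *)
Lemma cup_cohom_neq0 (c d : cohomology (raag e) F 1) :
  cup_cohom c d != 0 <->
  exists x y, e x y /\
    on_gen (repr c) x * on_gen (repr d) y
      != on_gen (repr c) y * on_gen (repr d) x.
Proof.
rewrite /cup_cohom; move: (repr c) (repr d) => z t {c d}.
have class0 : cohom_class (cup_cocycles z t) = 0 <-> is_coboundary (cup z t).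
  by rewrite -(linear0 (@cohom_class (raag e) F 2)) cohom_classP subr0.
split=> [nz|[x [y [exy]]]].
  apply: contrapT => noedge; case/eqP: nz; apply/class0.
  have minor0 x y : e x y -> on_gen z x * on_gen t y = on_gen z y * on_gen t x.
    by move=> exy; apply: contrapT => /eqP xy0; apply: noedge; exists x, y.
  pose H (g : raag e) := heisenberg (on_gen z) (on_gen t) (repr g).
  have HM g h :
      H (g * h)%g = H g + H h - val z (fun=> g) * val t (fun=> h).
    have -> : H (g * h)%g = heisenberg (on_gen z) (on_gen t) (repr g ++ repr h).
      by apply: (heisenberg_eq minor0); apply: word_eq_repr.
    rewrite heisenberg_cat -[in val z _](word_class_repr g).
    by rewrite -[in val t _](word_class_repr h) !cocycle_word.
  exists (fun x => H (x ord0)); apply/funext => x.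
  rewrite coboundary1E cup11E HM.
  have ringE (p c d : F) : p = d - (c + d - p) + c by ring.
  exact: ringE.
apply: contraNneq => /class0[h hE].
have cupE g g' : val z (fun=> g) * val t (fun=> g')
    = h (fun=> g') - h (fun=> (g * g')%g) + h (fun=> g).
  have := congr1 (fun f => f (fun i => if i == ord0 then g else g')) hE.
  by rewrite cup11E coboundary1E.
apply/eqP; rewrite /on_gen !cupE raag_gen_comm // addrAC [RHS]addrAC.
by congr (_ - _); exact: addrC.
Qed.

End CupProduct.

(** * Hamiltonian cycles as cyclic enumerations *)

Lemma cycle_nthP (T : Type) (x0 : T) (e : rel T) (s : seq T) :
  reflect (forall i, (i < size s)%N ->
             e (nth x0 s i) (nth x0 s (i.+1 %% size s)))
          (cycle e s).
Proof.
case: s => [|x p]; first exact: ReflectT.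
have nthE i : (i < (size p).+1)%N ->
    nth x0 (x :: rcons p x) i = nth x0 (x :: p) i
    /\ nth x0 (rcons p x) i = nth x0 (x :: p) (i.+1 %% (size p).+1).
  rewrite -rcons_cons !nth_rcons /= ltnS => lip; rewrite lip; split=> //.
  case: ltngtP lip => // [ltip|->] _; first by rewrite modn_small.
  by rewrite modnn.
apply: (iffP (pathP x0)) => pth i; rewrite ?size_rcons => lti.
  by have [<- <-] := nthE i lti; apply: pth; rewrite size_rcons.
by have [-> ->] := nthE i lti; apply: pth.
Qed.

Lemma hamiltonianP (T : finType) (e : rel T) :
  hamiltonian e <-> exists2 h : 'I_#|T| -> T, injective h &
    forall i, e (h i) (h (ordS i)).
Proof.
split=> [[s /andP[cyc uniq_s] s_all]|[h h_inj he]].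
  have sizeE : size s = #|T|.
    by rewrite -(card_uniqP uniq_s); apply: eq_card => v; rewrite s_all.
  rewrite -sizeE; exists (tnth (in_tuple s)); first exact/tuple_uniqP.
  move=> i; have x0 : T by exact: tnth (in_tuple s) i.
  by rewrite !(tnth_nth x0) /=; apply: (cycle_nthP x0 _ _ cyc).
exists (codom h) => [|v]; last first.
  by apply: (inj_card_onto h_inj); rewrite card_ord.
rewrite /ucycle map_inj_uniq // enum_uniq andbT.
have nthE x0 (i : 'I_#|T|) : nth x0 (codom h) i = h i.
  by rewrite (nth_map i) ?size_enum_ord // nth_ord_enum.
case: (pickP (mem T)) => [x0 _|T0]; last first.
  by case: (codom h) => // x s; have := T0 x.
apply/(cycle_nthP x0) => i; rewrite size_codom card_ord => ltiT.
by have := he (Ordinal ltiT); rewrite -!(nthE x0).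
Qed.

(** * Bases of the first cohomology *)

Section CyclicHamiltonian.
Variables (T : finType) (e : rel T) (F : fieldType).

Local Notation H1 := (cohomology (raag e) F 1).

HB.instance Definition _ := GRing.isLinear.Build F H1 'rV[F]_#|T| _ _
  (@raag_coords_linear T e F).

Lemma raag_coordsE (c : H1) i : raag_coords c 0 i = on_gen (repr c) (enum_val i).
Proof. by rewrite mxE. Qed.

Lemma raag_coords_inj : injective (@raag_coords T e F).
Proof. exact: bij_inj (@raag_coords_bij T e F). Qed.

Lemma dim_raag_H1 : \dim {: H1} = #|T|.
Proof. by rewrite dimvf. Qed.

Lemma free_det_raag_coords (w : #|T|.-tuple H1) :
  free w = (\det (\matrix_(i, j) raag_coords (tnth w i) 0 j) != 0).
Proof.
set A := \matrix_(i, j) _.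
have combE k : raag_coords (\sum_(i < #|T|) k i *: w`_i) = (\row_i k i) *m A.
  apply/rowP => j; rewrite linear_sum summxE mxE; apply: eq_bigr => i _.
  by rewrite linearZ !mxE (tnth_nth 0).
apply/freeP/idP => [free_w|detA k].
  apply/det0P => -[v v0 vA]; case/eqP: v0; apply/rowP => i; rewrite mxE.
  apply: (free_w (fun i => v 0 i)) => {i}; apply: raag_coords_inj.
  rewrite combE linear0 -[RHS]vA; congr (_ *m _).
  by apply/rowP => i; rewrite mxE.
move=> /(congr1 (@raag_coords T e F)); rewrite combE linear0 => kA i.
apply/eqP; apply: contraNT detA => ki0; apply/det0P; exists (\row_i k i) => //.
by apply: contraNneq ki0 => /rowP/(_ i); rewrite !mxE => ->.
Qed.

(** Composing the Hamiltonian cycle with the embedding of the graph in the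
adjacency graph of a basis gives the required order on the basis. *)
Lemma cyclic_hamiltonian_of_hamiltonian :
  symmetric e -> irreflexive e -> hamiltonian e ->
  cyclic_hamiltonian (cup_pairing e F).
Proof.
move=> e_sym e_irr /hamiltonianP[h h_inj he] n w w_basis.
have nE : n = #|T| by rewrite -(size_basis w_basis) dim_raag_H1.
subst n.
have := basis_free w_basis; rewrite free_det_raag_coords => detA.
pose e' : rel 'I_#|T| := fun i j => e (enum_val i) (enum_val j).
have [||s es] := @row_graph_embedding F #|T| e' _ _ _ detA.
- by move=> i j; exact: e_sym.
- by move=> i; exact: e_irr.
have [t tK] : exists t : 'S_#|T|, cancel t s.
  by exists (s^-1)%g; apply: permKV.
have p_inj : injective (fun i => t (enum_rank (h i))).
  by move=> i j /perm_inj/enum_rank_inj/h_inj.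
exists (perm p_inj) => i; rewrite !permE.
have [|k [m [ekm]]] := es (t (enum_rank (h i))) (t (enum_rank (h (ordS i)))).
  by rewrite !tK /e' !enum_rankK.
rewrite !mxE => minor; apply/cup_cohom_neq0.
by exists (enum_val k), (enum_val m).
Qed.

(** In the basis dual to the generators, the product of two classes is nonzero
only if their vertices form an edge. *)
Lemma hamiltonian_of_cyclic_hamiltonian :
  symmetric e -> cyclic_hamiltonian (cup_pairing e F) -> hamiltonian e.
Proof.
move=> e_sym chq; have [g _ gK] := @raag_coords_bij T e F.
pose w := [tuple g (delta_mx 0 i) | i < #|T|].
have wE i j : raag_coords (tnth w i) 0 j = (j == i)%:R.
  by rewrite tnth_mktuple gK mxE.
have w_basis : basis_of fullv w.
  rewrite basisEfree free_det_raag_coords subvf dim_raag_H1 size_tuple leqnn.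
  rewrite !andbT; set A := \matrix_(i, j) _.
  suff -> : A = 1%:M by rewrite det1 oner_eq0.
  by apply/matrixP => i j; rewrite [LHS]mxE wE mxE eq_sym.
have [s hs] := chq _ _ w_basis.
apply/hamiltonianP; exists (fun i => enum_val (s i)).
  by move=> i j /enum_val_inj/perm_inj.
move=> i; have /cup_cohom_neq0[x [y [exy]]] := hs i.
have onE j z : on_gen (repr (tnth w j)) z = (enum_rank z == j)%:R.
  by rewrite -{1}(enum_rankK z) -raag_coordsE wE.
rewrite !onE !(can2_eq enum_rankK enum_valK).
move: (enum_val (s i)) (enum_val (s (ordS i))) => v v'.
have [/andP[/eqP <- /eqP <-] //|xy] := boolP ((x == v) && (y == v')).
have [/andP[/eqP <- /eqP <-]|yx] := boolP ((y == v) && (x == v')).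
  by rewrite e_sym.
by rewrite -!natrM !mulnb (negPf xy) (negPf yx) eqxx.
Qed.

End CyclicHamiltonian.

Theorem theorem1p3 (T : finType) (e : rel T) (e_sym : symmetric e)
    (e_irr : irreflexive e) (F : fieldType) :
  hamiltonian e <->
  @cyclic_hamiltonian F (cohomology (raag e) F 1) (cohomology (raag e) F 2)
    (cup_pairing e F).
Proof.
split; first exact: cyclic_hamiltonian_of_hamiltonian.
exact: hamiltonian_of_cyclic_hamiltonian.
Qed.
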